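(* Let $m\le n$ and let $\Delta$ be a pure $(m-1)$-dimensional closed simplicial complex on the vertex set $[n]$ with clique decomposition $\Delta=\Delta_1\cup\cdots\cup\Delta_r$. If $J_\Delta$ is a prime ideal, then for every $2\le t\le\min(m,r)$ and any pairwise distinct cliques $\Delta_{i_1},\dots,\Delta_{i_t}$ one has $|V(\Delta_{i_1})\cap\cdots\cap V(\Delta_{i_t})|\le m-t$.
   Context: Let $K$ be a field, $X=(x_{ij})$ an $m\times n$ matrix of indeterminates, $S=K[X]$. For $1\le a_1<\dots<a_m\le n$, $[a_1\ldots a_m]$ is the maximal minor of $X$ with columns $a_1,\dots,a_m$. For a pure $(m-1)$-dimensional simplicial complex $\Delta$ on $[n]$ with facet set $\mathcal{F}(\Delta)$, $J_\Delta=(\mu_F : F\in\mathcal{F}(\Delta))$, $\mu_F=[a_1\ldots a_m]$ for $F=\{a_1<\dots<a_m\}$. Clique decomposition: let $\mathcal{S}$ be the set of simplices $\Gamma$ with vertices in $[n]$, $\dim\Gamma\ge m-1$, whose $(m-1)$-skeleton is contained in $\Delta$; let $\Gamma_1,\dots,\Gamma_r$ be the maximal elements of $\mathcal{S}$ and $\Delta_i=\Gamma_i^{(m-1)}$ (the cliques); then $\Delta=\Delta_1\cup\cdots\cup\Delta_r$; $V(\Delta_i)$ is the vertex set of $\Delta_i$. $\Delta$ is closed with respect to a labeling if for any two facets $F=\{a_1<\dots<a_m\}$, $G=\{b_1<\dots<b_m\}$ with $a_i=b_i$ for some $i$, every $m$-subset of $F\cup G$ is a facet of $\Delta$; $\Delta$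 is closed if it is closed with respect to some labeling (primality of $J_\Delta$ is independent of the labeling). *)

(* Defs.v *)
From HB Require Import structures.
From mathcomp Require Import all_boot all_order all_fingroup all_algebra.
Unset Printing Implicit Defensive.
Import GRing.Theory.
Local Open Scope ring_scope.

Fixpoint mpoly (R : comNzRingType) (k : nat) : comNzRingType :=
  match k with
  | 0 => R
  | k'.+1 => ({poly mpoly R k'} : comNzRingType)
  end.

(* The i-th variable of mpoly R k (i < k); the outermost variable has index 0.
   (Out-of-range indices give 0; they are never used below.) *)
Fixpoint mvar (R : comNzRingType) (k : nat) (i : nat) : mpoly R k :=
  match k return mpoly R k with
  | 0 => 0
  | k'.+1 => match i with
             | 0 => ('X : {poly mpoly R k'})
             | i'.+1 => ((mvar R k' i')%:P : {poly mpoly R k'})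
             end
  end.

Definition Sring (K : fieldType) (m n : nat) : comNzRingType := mpoly K (m * n).

Definition xvar (K : fieldType) (m n : nat) (i k : nat) : Sring K m n :=
  mvar K (m * n) (i * n + k).

Definition sorted_elt (n : nat) (F : {set 'I_n}) (j : nat) : nat :=
  nth 0%N (sort leq [seq val x | x <- enum F]) j.

Definition minor_of (K : fieldType) (m n : nat) (F : {set 'I_n}) : Sring K m n :=
  \det (\matrix_(i < m, j < m) xvar K m n i (sorted_elt n F j)).

(* A simplicial complex Delta is given by its set of facets.
   Pure (m-1)-dimensional: nonempty, every facet has exactly m vertices. *)
Definition pure_dim (n m : nat) (D : {set {set 'I_n}}) : Prop :=
  D != set0 /\ forall F, F \in D -> #|F| = m.

Definition in_JDelta (K : fieldType) (m n : nat) (D : {set {set 'I_n}})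
  (f : Sring K m n) : Prop :=
  exists c : {set 'I_n} -> Sring K m n, f = \sum_(F in D) c F * minor_of K m n F.

Definition JDelta_prime (K : fieldType) (m n : nat) (D : {set {set 'I_n}}) : Prop :=
  ~ in_JDelta K m n D 1 /\
  forall f g : Sring K m n, in_JDelta K m n D (f * g) ->
    in_JDelta K m n D f \/ in_JDelta K m n D g.

(* Closedness with respect to the labeling sigma (vertex v gets label sigma v). *)
Definition closed_wrt (n m : nat) (sigma : {perm 'I_n}) (D : {set {set 'I_n}}) : Prop :=
  forall F G, F \in D -> G \in D ->
    forall i, (i < m)%N ->
      sorted_elt n (sigma @: F) i = sorted_elt n (sigma @: G) i ->
      forall H : {set 'I_n}, H \subset F :|: G -> #|H| = m -> H \in D.

Definition closed_complex (n m : nat) (D : {set {set 'I_n}}) : Prop :=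
  exists sigma : {perm 'I_n}, closed_wrt n m sigma D.

(* Gamma (a simplex, given by its vertex set) is in the family S:
   dim Gamma >= m-1 and its (m-1)-skeleton is contained in Delta. *)
Definition in_S (n m : nat) (D : {set {set 'I_n}}) (Gam : {set 'I_n}) : bool :=
  (m <= #|Gam|)%N &&
  [forall H : {set 'I_n}, ((H \subset Gam) && (#|H| == m)) ==> (H \in D)].

(* The cliques Delta_i = Gamma_i^{(m-1)}, represented by the maximal Gamma_i;
   V(Delta_i) = Gamma_i (since dim Gamma_i >= m-1). *)
Definition cliques (n m : nat) (D : {set {set 'I_n}}) : {set {set 'I_n}} :=
  [set Gam | maxset (in_S n m D) Gam].

(* Main.v *)
(* Suppose t cliques have at least s = m - t + 1 common vertices W, and let v be
   in W.  For each of these cliques, v and the first m - 1 other vertices form a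
   facet; the maximal minors of the m - 1 columns other than v form the normal
   vector of a hyperplane which, modulo J, contains all columns of W.  Hence a
   t x t minor of the normal vectors times an s x s minor of the columns W lies
   in J, because t + s > m.  The second factor is not in J (evaluate at a matrix
   of rank less than m), so primality forces the first one into J.

   This is refuted by a matrix over K[tau] at which all generators of J vanish.
   Its entry in row r and column c has degree r * label(c), up to a shift
   depending only on c, so that by the rearrangement inequality every minor is
   dominated by its diagonal.  The column v is zero, and the last entry of a
   column c that is the last vertex of a facet avoiding v is determined by that
   facet.  The normal vector of a clique is then dominated by its entry at the
   position of v in the chosen facet.  These positions differ: by primality two
   cliques share at most m - 2 vertices, so by closedness facets of distinct
   cliques never have the same vertex at the same position.  *)
Require Import Defs.
From HB Require Import structures.
From mathcomp Require Import all_boot all_order all_fingroup all_algebra.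
From mathcomp Require Import zify.
Set Implicit Arguments.
Unset Strict Implicit.
Import GRing.Theory.
Local Open Scope ring_scope.

(** * Determinants and ideals *)

(** A function picks the columns, so repetitions and arbitrary orders are allowed. *)
Definition colmx (R : comNzRingType) m n (x : 'I_m -> 'I_n -> R)
  (f : 'I_m -> 'I_n) : 'M[R]_m := \matrix_(i, j) x i (f j).

Definition replace_col (R : comNzRingType) m (A : 'M[R]_m) (j : 'I_m)
  (y : 'I_m -> R) : 'M[R]_m := \matrix_(i, l) (if l == j then y i else A i l).

Definition replace_at m (T : Type) (f : 'I_m -> T) (j : 'I_m) (c : T) : 'I_m -> T :=
  fun l => if l == j then c else f l.

Definition is_ideal (R : comNzRingType) (I : R -> Prop) : Prop :=
  [/\ I 0, forall a b, I a -> I b -> I (a + b) & forall a b, I b -> I (a * b)].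

Section Determinants.
Variable R : comNzRingType.
Implicit Types (I : R -> Prop).

Lemma ideal_sum I (T : Type) (r : seq T) (P : pred T) (F : T -> R) :
  is_ideal I -> (forall i, P i -> I (F i)) -> I (\sum_(i <- r | P i) F i).
Proof. by case=> I0 ID _ FI; apply: (big_ind I). Qed.

Lemma zero_is_ideal : is_ideal (fun a : R => a = 0).
Proof. by split=> // [a b -> ->|a b ->]; rewrite ?addr0 ?mulr0. Qed.

Lemma det_replace_col m (A : 'M[R]_m) j y :
  \det (replace_col A j y) = \sum_k cofactor A k j * y k.
Proof.
rewrite (expand_det_col _ j); apply: eq_bigr => k _.
rewrite !mxE eqxx mulrC /cofactor; congr (_ * \det _ * _).
by apply/matrixP=> a b; rewrite !mxE eq_sym (negPf (neq_lift _ _)).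
Qed.

Lemma adj_mulmx m (A X : 'M[R]_m) j c :
  (\adj A *m X) j c = \det (replace_col A j (fun k => X k c)).
Proof. by rewrite det_replace_col mxE; apply: eq_bigr => k _; rewrite mxE. Qed.

(** Since [\det P ^+ m] is the determinant of [P *m \adj P], the product is a multiple of the
    determinant of [\adj P *m X], whose row [j] lies in [I]. *)
Lemma det_adj_row_ideal I m (P X : 'M[R]_m) j :
  is_ideal I -> (forall c, I ((\adj P *m X) j c)) ->
  I (\det P ^+ m * \det X).
Proof.
move=> idI rowI; have [_ _ IM] := idI.
rewrite -det_scalar -mul_mx_adj det_mulmx -mulrA; apply (IM).
rewrite -det_mulmx (expand_det_row _ j); apply: ideal_sum => // c _.
by rewrite mulrC; apply: IM.
Qed.

(** By counting, every permutation sends some row of [A] to a column of [B], so every Leibniz term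
    has a factor in [I]. *)
Lemma det_block_ideal I m (N : 'M[R]_m) (A B : {set 'I_m}) :
  is_ideal I -> (m < #|A| + #|B|)%N ->
  (forall i j, i \in A -> j \in B -> I (N i j)) -> I (\det N).
Proof.
move=> idI ltm blockI; have [_ _ IM] := idI.
apply: ideal_sum => // s _; apply (IM).
have [i iA siB] : exists2 i, i \in A & s i \in B.
  have : (0 < #|[set s i | i in A] :&: B|)%N.
    have cA : #|[set s i | i in A]| = #|A| by rewrite card_imset //; apply: perm_inj.
    have := cardsUI [set s i | i in A] B; rewrite cA.
    have := subset_leq_card (subsetT ([set s i | i in A] :|: B)).
    by rewrite cardsT card_ord; move: ltm; clear; move: #|_ :|: B| #|_ :&: B|; lia.
  by case/card_gt0P=> _ /setIP[/imsetP[i iA ->] siB]; exists i.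
by rewrite (bigD1 i) //= mulrC; apply: IM; apply: blockI.
Qed.

Lemma colmx_replace m n (x : 'I_m -> 'I_n -> R) f j c :
  replace_col (colmx x f) j (x^~ c) = colmx x (replace_at f j c).
Proof. by apply/matrixP=> a b; rewrite !mxE /replace_at; case: eqP. Qed.

Lemma det_colmx_perm m n (x : 'I_m -> 'I_n -> R) f (s : 'S_m) :
  \det (colmx x (f \o s)) = (-1) ^+ s * \det (colmx x f).
Proof.
have -> : colmx x (f \o s) = col_perm s (colmx x f).
  by apply/matrixP=> a b; rewrite !mxE.
by rewrite col_permE det_mulmx det_perm odd_permV mulrC.
Qed.

Lemma det_colmx_noninj m n (x : 'I_m -> 'I_n -> R) f :
  ~~ injectiveb f -> \det (colmx x f) = 0.
Proof.
case/injectivePn=> i [j ij fij]; rewrite -det_tr.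
by apply: (determinant_alternate ij) => k; rewrite !mxE fij.
Qed.

End Determinants.

Lemma same_image_perm m n (f g : 'I_m -> 'I_n) :
  injective f -> [set f i | i : 'I_m] = [set g i | i : 'I_m] ->
  exists s : 'S_m, f =1 g \o s.
Proof.
move=> finj fg.
have pre i : {k | f i == g k}.
  apply: sigW; have : f i \in [set g i | i : 'I_m] by rewrite -fg imset_f.
  by case/imsetP=> k _ ->; exists k.
have hinj : injective (fun i => sval (pre i)).
  move=> i j /= eij; apply: finj.
  by have /eqP-> := svalP (pre i); have /eqP-> := svalP (pre j); rewrite eij.
by exists (perm hinj) => i /=; rewrite permE; apply/eqP/(svalP (pre i)).
Qed.

Lemma det_colmx_eq0 (R : comNzRingType) m n (x : 'I_m -> 'I_n -> R) f g :
  injective f -> [set f i | i : 'I_m] = [set g i | i : 'I_m] ->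
  \det (colmx x g) = 0 -> \det (colmx x f) = 0.
Proof.
move=> finj fg g0; have [s fE] := same_image_perm finj fg.
have -> : colmx x f = colmx x (g \o s) by apply/matrixP=> a b; rewrite !mxE fE.
by rewrite det_colmx_perm g0 mulr0.
Qed.

(** * Degrees of determinants of polynomials *)

Section TopCoefficients.
Variable K : fieldType.

(** [e] only bounds the degrees; if a factor falls short of its bound, both coefficients are
    zero. *)
Lemma coef_prod_top (T : Type) (r : seq T) (F : T -> {poly K}) (e : T -> nat) :
  (forall i, size (F i) <= (e i).+1)%N ->
  (size (\prod_(i <- r) F i)%R <= (\sum_(i <- r) e i).+1)%N /\
  (\prod_(i <- r) F i)`_(\sum_(i <- r) e i) = \prod_(i <- r) (F i)`_(e i).
Proof.
move=> leF; elim: r => [|i r [IHs IHc]].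
  by rewrite !big_nil size_poly1 coef1.
rewrite !big_cons; split.
  apply: leq_trans (size_polyMleq _ _) _.
  by have := leF i; move: IHs; lia.
rewrite -IHc coefM {IHc}.
move: (\prod_(j <- r) F j) (\sum_(j <- r) e j)%N IHs => q E IHs.
have lt : (e i < (e i + E).+1)%N by lia.
rewrite (bigD1 (Ordinal lt)) //= addKn big1 ?addr0 // => k.
rewrite -val_eqE /= => ki.
have [ltk|lek] := ltnP k (e i).
  rewrite [X in _ * X]nth_default ?mulr0 //; apply: leq_trans IHs _.
  by have := ltn_ord k; lia.
rewrite nth_default ?mul0r //; apply: leq_trans (leF i) _.
by rewrite ltn_neqAle eq_sym ki.
Qed.

(** All Leibniz products share the degree bound [\sum_i e i], so taking that coefficient commutes
    with the expansion. *)
Lemma coef_det_rows m (A : 'M[{poly K}]_m) (e : 'I_m -> nat) :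
  (forall i j, size (A i j) <= (e i).+1)%N ->
  (\det A)`_(\sum_i e i) = \det (\matrix_(i, j) (A i j)`_(e i)).
Proof.
move=> leA; rewrite /determinant coef_sum; apply: eq_bigr => s _.
have [_] := @coef_prod_top _ (index_enum 'I_m) (fun i => A i (s i)) e
  (fun i => leA i (s i)).
rewrite (eq_bigr (fun i => ((\matrix_(i, j) (A i j)`_(e i)) : 'M_m) i (s i))).
  by rewrite !mulr_sign; case: (odd_perm s); rewrite ?coefN => ->.
by move=> i _; rewrite mxE.
Qed.

Lemma rearrangement m (a : 'I_m -> nat) (s : 'S_m) :
  {homo a : i j / (i < j)%N} -> s != 1%g ->
  (\sum_(i < m) i * a (s i) < \sum_(i < m) i * a i)%N.
Proof.
move=> amono s1; pose S (u : 'S_m) := (\sum_(i < m) i * a (u i))%N.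
(* Only the identity can maximize [S]: if [i] is the least non-fixed point of [u] and [j] its
   preimage, swapping the values at [i] and [j] gains [(j - i) * (a (u i) - a i)]. *)
have better (u : 'S_m) : u != 1%g -> exists u', (S u < S u')%N.
  move=> u1.
  have [i0 ui0] : exists i, u i != i.
    apply/existsP; apply: contraNT u1 => /existsPn fixu.
    by apply/eqP/permP=> i; rewrite perm1; apply/eqP; have := fixu i; rewrite negbK.
  have [i ui mini] := @arg_minnP _ i0 (fun i => u i != i) val ui0.
  pose j := (u^-1)%g i; have uj : u j = i by rewrite permKV.
  have fixlt (k : 'I_m) : (k < i)%N -> u k = k.
    by move=> ki; apply/eqP; apply: contraTT ki => uk; rewrite -leqNgt; exact: mini.
  have ji : j != i by apply: contraNneq ui => ji; rewrite -{1}ji uj.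
  have ij : (i < j)%N.
    rewrite ltn_neqAle eq_sym ji /= leqNgt; apply: contraNN ji => jlt.
    by rewrite -[X in X == _](fixlt _ jlt) uj.
  have iu : (i < u i)%N.
    rewrite ltn_neqAle eq_sym ui /= leqNgt; apply: contraNN ui => ult.
    by apply/eqP/(@perm_inj _ u); apply: fixlt.
  exists (tperm i j * u)%g; rewrite /S.
  rewrite (bigD1 i) //= (bigD1 j) //= [X in (_ < X)%N](bigD1 i) //= [X in (_ < _ + X)%N](bigD1 j) //=.
  rewrite !permM tpermL tpermR uj.
  rewrite (eq_bigr (fun k : 'I_m => k * a ((tperm i j * u)%g k))%N); last first.
    by move=> k /andP[ki kj]; rewrite permM tpermD // eq_sym.
  have := amono _ _ iu; move: (a i) (a (u i)) => p q pq.
  rewrite !addnA ltn_add2r; nia.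
have [u _ maxu] := @arg_maxnP _ s predT S isT.
have u1 : u = 1%g.
  apply/eqP; apply: contraT => /better[u' lt].
  by have /(leq_trans lt) := maxu u' isT; rewrite ltnn.
have [s' lts] := better _ s1.
apply: leq_trans lts _; apply: leq_trans (maxu s' isT) _.
by rewrite u1 /S; apply: leq_sum => i _; rewrite perm1.
Qed.

(* By rearrangement only the identity permutation reaches the top degree. *)
Lemma coef_det_diag m (A : 'M[{poly K}]_m) (a d : 'I_m -> nat) :
  {homo a : i j / (i < j)%N} ->
  (forall i j, size (A i j) <= (i * a j + d j).+1)%N ->
  let E := (\sum_(i < m) (i * a i + d i))%N in
  (size (\det A) <= E.+1)%N /\
  (\det A)`_E = \prod_(i < m) (A i i)`_(i * a i + d i).
Proof.
move=> amono leA E.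
have sumE (s : 'S_m) : (\sum_(i < m) (i * a (s i) + d (s i)) =
    \sum_(i < m) i * a (s i) + \sum_i d i)%N.
  by rewrite big_split /= [X in (_ = _ + X)%N](reindex_perm s).
have E1 : E = (\sum_(i < m) i * a i + \sum_i d i)%N by rewrite /E big_split.
have lt (s : 'S_m) : s != 1%g -> (\sum_(i < m) (i * a (s i) + d (s i)) < E)%N.
  by move=> s1; rewrite sumE E1 ltn_add2r rearrangement.
have top (s : 'S_m) := @coef_prod_top _ (index_enum 'I_m) (fun i => A i (s i))
  (fun i => i * a (s i) + d (s i))%N (fun i => leA i (s i)).
have small (s : 'S_m) : s != 1%g -> (size ((-1) ^+ s * \prod_i A i (s i))%R <= E)%N.
  move=> s1; have [sz _] := top s.
  by rewrite mulr_sign; case: ifP => _; rewrite ?size_polyN; apply: leq_trans sz (lt _ s1).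
have [sz1 c1] := top 1%g.
have e1 : (\sum_(i < m) (i * a ((1%g : 'S_m) i) + d ((1%g : 'S_m) i)) = E)%N.
  by apply: eq_bigr => i _; rewrite perm1.
rewrite e1 in sz1 c1.
have d1 : \det A = \prod_i A i ((1%g : 'S_m) i) +
    \sum_(s : 'S_m | s != 1%g) (-1) ^+ s * \prod_i A i (s i).
  by rewrite /determinant (bigD1 (1%g : 'S_m)) //= odd_perm1 mul1r.
have szr : (size (\sum_(s : 'S_m | s != 1%g) (-1) ^+ s * \prod_i A i (s i))%R <= E)%N.
  by apply: leq_trans (size_sum _ _ _) _; apply/bigmax_leqP=> s s1; apply: small.
split; rewrite d1.
  by apply: leq_trans (size_polyD _ _) _; rewrite geq_max sz1 ltnW.
rewrite coefD (nth_default _ szr) addr0 c1.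
by apply: eq_bigr => i _; rewrite perm1.
Qed.

End TopCoefficients.

(** * Evaluation and the facet ideal *)

Lemma mpoly_eval (K R : comNzRingType) (h : {rmorphism K -> R}) k (a : nat -> R) :
  exists phi : {rmorphism mpoly K k -> R},
    forall i, (i < k)%N -> phi (mvar K k i) = a i.
Proof.
elim: k a => [|k IH] a; first by exists h.
have [phi phiE] := IH (fun i => a i.+1).
have comm : commr_rmorph phi (a 0%N) by move=> c; apply: mulrC.
exists (horner_morph comm : {rmorphism {poly mpoly K k} -> R}) => -[_|i ik] /=.
  by rewrite horner_morphX.
by rewrite horner_morphC phiE.
Qed.

Lemma Sring_eval (K : fieldType) m n (x : 'I_m -> 'I_n -> {poly K}) :
  exists phi : {rmorphism Sring K m n -> {poly K}},
    forall (i : 'I_m) (c : 'I_n), phi (xvar K m n i c) = x i c.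
Proof.
(* Row [i] and column [c] have index [i * n + c], which division by [n] decodes; below [m * n] the
   defaults 0 are never reached. *)
pose a k := if insub (k %/ n)%N is Some i then
            if insub (k %% n)%N is Some c then x i c else 0 else 0.
have [phi phiE] := mpoly_eval (polyC : {rmorphism K -> {poly K}}) (m * n) a.
exists phi => i c; rewrite /xvar phiE; last first.
  by have := ltn_ord i; have := ltn_ord c; nia.
have c_lt := ltn_ord c.
rewrite /a divnMDl ?divn_small ?addn0; [|lia..].
rewrite modnMDl modn_small // !insubT //= => *.
by congr (x _ _); apply: val_inj.
Qed.

Definition increasing m n (sigma : {perm 'I_n}) (f : 'I_m -> 'I_n) : Prop :=
  forall i j : 'I_m, (i < j)%N -> (sigma (f i) < sigma (f j))%N.

Lemma increasing_inj m n (sigma : {perm 'I_n}) (f : 'I_m -> 'I_n) :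
  increasing sigma f -> injective f.
Proof.
move=> fincr i j fij; apply: val_inj; case: (ltngtP i j) => // /fincr;
by rewrite fij ltnn.
Qed.

Lemma increasing_enum m n (sigma : {perm 'I_n}) (F : {set 'I_n}) :
  #|F| = m ->
  exists2 f : 'I_m -> 'I_n, increasing sigma f & [set f i | i : 'I_m] = F.
Proof.
move=> cF; pose r : rel 'I_n := fun x y => (sigma x <= sigma y)%N.
pose s := sort r (enum F).
have sz : size s == m by rewrite size_sort -cardE cF.
pose f i := tnth (Tuple sz) i.
have memf i : f i \in F by rewrite -mem_enum -(mem_sort r) mem_tnth.
have us : uniq s by rewrite sort_uniq enum_uniq.
have fincr : increasing sigma f.
  move=> i j ij.
  have ss : sorted r s by apply: sort_sorted => x y; apply: leq_total.
  have rtr : transitive r by move=> x y z; apply: leq_trans.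
  have lt_s (k : 'I_m) : (k < size s)%N by rewrite (eqP sz).
  have := sorted_ltn_nth rtr (f i) ss i j (lt_s i) (lt_s j) ij.
  rewrite -!(tnth_nth _ (Tuple sz)) -/(f i) -/(f j) /r leq_eqVlt => /orP[|//].
  rewrite val_eqE => /eqP/perm_inj/eqP; rewrite /f !(tnth_nth (f i)) nth_uniq //=.
  by move/eqP=> eij; rewrite eij ltnn in ij.
exists f => //; apply/eqP; rewrite eqEcard; apply/andP; split.
  by apply/subsetP=> _ /imsetP[i _ ->].
by rewrite card_imset ?card_ord ?cF //; apply: increasing_inj fincr.
Qed.

(** A strictly increasing list is determined by its elements. This turns the positions in
    [closed_wrt] into values of increasing enumerations. *)
Lemma sorted_elt_increasing m n (sigma : {perm 'I_n}) (f : 'I_m -> 'I_n) (i : 'I_m) :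
  increasing sigma f ->
  sorted_elt n (sigma @: [set f i | i : 'I_m]) i = sigma (f i).
Proof.
move=> fincr.
have srt : sorted ltn [seq val (sigma (f j)) | j <- enum 'I_m].
  rewrite sorted_map; have : sorted ltn [seq val j | j <- enum 'I_m].
    by rewrite val_enum_ord iota_ltn_sorted.
  by rewrite sorted_map; apply: sub_sorted => j k; apply: fincr.
rewrite /sorted_elt; set s := sort _ _.
have -> : s = [seq val (sigma (f j)) | j <- enum 'I_m].
  apply: (irr_sorted_eq ltn_trans ltnn) => //.
    rewrite ltn_sorted_uniq_leq sort_uniq (map_inj_uniq val_inj) enum_uniq /=.
    by apply: sort_sorted; apply: leq_total.
  move=> k; rewrite mem_sort; apply/mapP/mapP => -[x].
    rewrite mem_enum => /imsetP[_ /imsetP[j _ ->] ->] ->.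
    by exists j; rewrite ?mem_enum.
  by move=> _ ->; exists (sigma (f x)); rewrite ?mem_enum // !imset_f.
by rewrite (nth_map i) ?size_enum_ord // nth_ord_enum.
Qed.

Section FacetIdeal.
Variables (K : fieldType) (m n : nat) (D : {set {set 'I_n}}).
Implicit Types A F Gam : {set 'I_n}.
Hypothesis pureD : forall F, F \in D -> #|F| = m.

Let xv (i : 'I_m) (c : 'I_n) : Sring K m n := xvar K m n i c.

Lemma minor_of_colmx F : #|F| = m ->
  exists g : 'I_m -> 'I_n, [/\ injective g, [set g i | i : 'I_m] = F &
    minor_of K m n F = \det (colmx xv g)].
Proof.
move=> cF; have [g gincr gF] := increasing_enum 1%g cF.
exists g; split=> //; first exact: increasing_inj gincr.
congr (\det _); apply/matrixP=> i j; rewrite !mxE /xv.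
have := sorted_elt_increasing j gincr; rewrite gF perm1.
by rewrite (eq_imset _ (@perm1 _)) imset_id => ->.
Qed.

Lemma JDelta_is_ideal : is_ideal (in_JDelta K m n D).
Proof.
split.
- by exists (fun=> 0); rewrite big1 // => F _; rewrite mul0r.
- move=> _ _ [c ->] [d ->]; exists (fun F => c F + d F).
  by rewrite -big_split; apply: eq_bigr => F _; rewrite mulrDl.
move=> a _ [c ->]; exists (fun F => a * c F).
by rewrite mulr_sumr; apply: eq_bigr => F _; rewrite mulrA.
Qed.

(** A repeated column gives determinant 0; otherwise the determinant is a generator up to sign. *)
Lemma JDelta_colmx (f : 'I_m -> 'I_n) :
  (injective f -> [set f i | i : 'I_m] \in D) ->
  in_JDelta K m n D (\det (colmx xv f)).
Proof.
have [J0 _ JM] := JDelta_is_ideal.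
case: (boolP (injectiveb f)) => [/injectiveP finj /(_ finj) FD|/det_colmx_noninj-> //].
have [g [_ gF gE]] := minor_of_colmx (pureD FD).
have [s fE] := same_image_perm finj (esym gF).
have -> : colmx xv f = colmx xv (g \o s) by apply/matrixP=> a b; rewrite !mxE fE.
rewrite det_colmx_perm -gE; apply: JM.
exists (fun G => (G == [set f i | i : 'I_m])%:R).
rewrite (bigD1 _ FD) /= eqxx mul1r big1 ?addr0 // => G /andP[_ /negPf->].
by rewrite mul0r.
Qed.

(** Serves to prove non-membership, by exhibiting a common zero of the generators. *)
Lemma JDelta_eval (x : 'I_m -> 'I_n -> {poly K}) (phi : {rmorphism Sring K m n -> {poly K}}) p :
  (forall i c, phi (xv i c) = x i c) ->
  (forall g : 'I_m -> 'I_n, injective g -> [set g i | i : 'I_m] \in D ->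
     \det (colmx x g) = 0) ->
  in_JDelta K m n D p -> phi p = 0.
Proof.
move=> phix x0 [c ->]; rewrite rmorph_sum big1 // => F FD.
have [g [ginj gF ->]] := minor_of_colmx (pureD FD).
rewrite rmorphM -det_map_mx; have -> : map_mx phi (colmx xv g) = colmx x g.
  by apply/matrixP=> i j; rewrite !mxE phix.
by rewrite x0 ?mulr0 // gF.
Qed.

Lemma JDelta_facet (h : 'I_m -> 'I_n) :
  injective h -> in_JDelta K m n D (\det (colmx xv h)) ->
  [set h i | i : 'I_m] \in D.
Proof.
move=> hinj; apply: contraPT => HD.
(* Column [h i] is the i-th unit vector and all other columns vanish, so every minor using a column
   outside the image of [h] is 0. *)
pose x (i : 'I_m) c : {poly K} := (h i == c)%:R.
have [phi phix] := Sring_eval x.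
move=> /(JDelta_eval phix) phi0.
have : phi (\det (colmx xv h)) = 1.
  rewrite -det_map_mx -[RHS](det1 _ m); congr (\det _).
  by apply/matrixP=> i j; rewrite !mxE phix /x (inj_eq hinj).
rewrite phi0 => [/esym/eqP|g ginj GD]; first by rewrite oner_eq0.
have [j gj] : exists j, g j \notin [set h i | i : 'I_m].
  apply/existsP; apply: contraNT HD => /existsPn gh; suff <- : [set g i | i : 'I_m] = [set h i | i : 'I_m] by [].
  apply/eqP; rewrite eqEcard !card_imset //= leqnn andbT.
  by apply/subsetP=> _ /imsetP[i _ ->]; have := gh i; rewrite negbK.
rewrite (expand_det_col _ j) big1 // => i _; rewrite mxE /x.
by case: eqP gj => [<-|_ _]; rewrite ?imset_f ?mul0r.
Qed.

End FacetIdeal.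

(** An s x s minor at full size: the unit vectors in the last columns reduce the determinant to the
    first [s] rows of the first [s] chosen columns. *)
Definition partial_colmx (R : comNzRingType) m n s (x : 'I_m -> 'I_n -> R)
  (w : 'I_m -> 'I_n) : 'M[R]_m :=
  \matrix_(k, j) (if (j < s)%N then x k (w j) else (k == j)%:R).

(** * Cliques *)

Section Cliques.
Variables (K : fieldType) (m n : nat) (D : {set {set 'I_n}}).
Implicit Types A F Gam : {set 'I_n}.
Hypothesis pureD : forall F, F \in D -> #|F| = m.+1.
Let xv (i : 'I_m.+1) (c : 'I_n) : Sring K m.+1 n := xvar K m.+1 n i c.

Lemma partial_colmx_notin s (w : 'I_m.+1 -> 'I_n) :
  (s <= m)%N ->
  (forall i j : 'I_m.+1, (i < s)%N -> (j < s)%N -> w i = w j -> i = j) ->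
  ~ in_JDelta K m.+1 n D (\det (partial_colmx s xv w)).
Proof.
move=> sm winj.
(* The last row of this point is zero, which kills all maximal minors, while the partial matrix
   becomes the identity. *)
pose x (k : 'I_m.+1) c : {poly K} := ((k < s)%N && (w k == c))%:R.
have [phi phix] := Sring_eval x.
move=> /(JDelta_eval pureD phix) phi0.
have : phi (\det (partial_colmx s xv w)) = 1.
  rewrite -det_map_mx -[RHS](det1 _ m.+1); congr (\det _).
  apply/matrixP=> i j; rewrite !mxE; case: ltnP => js; last by rewrite rmorph_nat.
  rewrite phix /x; congr ((_ : bool)%:R); apply/andP/eqP => [[is_ /eqP]|->].
    exact: winj.
  by rewrite js.
rewrite phi0 => [/esym/eqP|g ginj GD]; first by rewrite oner_eq0.
rewrite (expand_det_row _ ord_max) big1 // => j _; rewrite mxE /x.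
by rewrite /= ltnNge sm mul0r.
Qed.

Lemma in_SP Gam : reflect
  ((m < #|Gam|)%N /\ forall H : {set 'I_n}, H \subset Gam -> #|H| = m.+1 -> H \in D)
  (in_S n m.+1 D Gam).
Proof.
apply: (iffP andP) => -[cG sub]; split=> //.
  move=> H HG cH; move/forallP/(_ H): sub; rewrite HG cH eqxx; exact.
by apply/forallP=> H; apply/implyP=> /andP[HG /eqP]; apply: sub.
Qed.

Lemma clique_in_S Gam : Gam \in cliques n m.+1 D -> in_S n m.+1 D Gam.
Proof. by rewrite inE => /maxsetp. Qed.

Lemma clique_max Gam Gam' : Gam \in cliques n m.+1 D -> in_S n m.+1 D Gam' ->
  Gam \subset Gam' -> Gam' = Gam.
Proof. by rewrite inE => /maxsetP[_ maxG] SG'; apply: maxG. Qed.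

Lemma clique_minor Gam (f : 'I_m.+1 -> 'I_n) : Gam \in cliques n m.+1 D ->
  (forall i, f i \in Gam) -> in_JDelta K m.+1 n D (\det (colmx xv f)).
Proof.
move=> /clique_in_S/in_SP[_ sub] fG; apply: JDelta_colmx => // finj.
apply: sub; last by rewrite card_imset ?card_ord.
by apply/subsetP=> _ /imsetP[i _ ->].
Qed.

(* Modulo J, all columns of both cliques lie in the span of m - 1 common ones. *)
Lemma cliques_share Gam Gam' : JDelta_prime K m.+1 n D ->
  Gam \in cliques n m.+1 D -> Gam' \in cliques n m.+1 D ->
  (m <= #|Gam :&: Gam'|)%N -> Gam = Gam'.
Proof.
move=> [J1 primeJ] cG cG' lem.
have sz : (m <= size (enum (Gam :&: Gam')))%N by rewrite -cardE.
(* By maximality both cliques then equal their union. *)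
suff SU : in_S n m.+1 D (Gam :|: Gam').
  by rewrite -[LHS](clique_max cG SU) ?subsetUl // (clique_max cG' SU) ?subsetUr.
have /in_SP[mG _] := clique_in_S cG.
apply/in_SP; split=> [|H HU cH].
  by apply: leq_trans mG _; apply: subset_leq_card; apply: subsetUl.
have [h hincr hH] := increasing_enum 1%g cH.
have hinj := increasing_inj hincr.
pose w (j : 'I_m.+1) := nth (h ord0) (enum (Gam :&: Gam')) j.
pose P := partial_colmx m xv w.
have nP : ~ in_JDelta K m.+1 n D (\det P).
  apply: partial_colmx_notin => // i j im jm /eqP.
  rewrite nth_uniq ?enum_uniq ?(leq_trans im) ?(leq_trans jm) // => /eqP.
  exact: val_inj.
have nPk k : ~ in_JDelta K m.+1 n D (\det P ^+ k).
  elim: k => [|k IH]; first by rewrite expr0.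
  by rewrite exprS => /primeJ[].
rewrite -hH; apply: (@JDelta_facet K m.+1 n D pureD h hinj).
(* Primality cancels the power of [\det P]. It remains to treat minors on [m] common vertices and
   one vertex of [h], all inside one of the two cliques. *)
suff : in_JDelta K m.+1 n D (\det P ^+ m.+1 * \det (colmx xv h)).
  by case/primeJ => // /nPk[].
apply: (det_adj_row_ideal (JDelta_is_ideal K m.+1 D) (j := ord_max)) => c.
rewrite adj_mulmx.
have -> : replace_col P ord_max (fun k => colmx xv h k c) =
          colmx xv (replace_at w ord_max (h c)).
  apply/matrixP=> k j; rewrite !mxE /replace_at; case: eqP => // jm.
  suff -> : (j < m)%N by [].
  by rewrite ltn_neqAle -ltnS ltn_ord andbT; apply/eqP => e; apply: jm; apply: val_inj.
have memw (j : 'I_m.+1) : j != ord_max -> w j \in Gam :&: Gam'.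
  move=> jm; rewrite -mem_enum mem_nth //; apply: leq_trans sz.
  by rewrite ltn_neqAle -ltnS ltn_ord andbT; apply: contraNneq jm => e; apply/eqP/val_inj.
have : h c \in Gam :|: Gam' by rewrite (subsetP HU) // -hH imset_f.
case/setUP => hc; [apply: (clique_minor cG)|apply: (clique_minor cG')] => j;
  rewrite /replace_at; case: eqP => // /eqP/memw; rewrite inE => /andP[] //.
Qed.

Lemma in_S_clique A : in_S n m.+1 D A ->
  exists2 Gam, Gam \in cliques n m.+1 D & A \subset Gam.
Proof.
move=> SA; have [Gam maxG AG] := maxset_exists (P := in_S n m.+1 D) SA.
by exists Gam => //; rewrite inE.
Qed.

Lemma facet_clique F : F \in D ->
  exists2 Gam, Gam \in cliques n m.+1 D & F \subset Gam.
Proof.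
move=> FD; apply: in_S_clique; apply/in_SP; split=> [|H HF cH]; first by rewrite pureD.
suff -> : H = F by [].
by apply/eqP; rewrite eqEcard HF (pureD FD) cH leqnn.
Qed.

Lemma closed_increasing sigma (f g : 'I_m.+1 -> 'I_n) i :
  closed_wrt n m.+1 sigma D -> increasing sigma f -> increasing sigma g ->
  [set f j | j : 'I_m.+1] \in D -> [set g j | j : 'I_m.+1] \in D -> f i = g i ->
  forall H : {set 'I_n}, H \subset [set f j | j : 'I_m.+1] :|: [set g j | j : 'I_m.+1] ->
  #|H| = m.+1 -> H \in D.
Proof.
move=> cl fincr gincr fD gD fg; apply: (cl _ _ fD gD i) => //.
by rewrite !sorted_elt_increasing // fg.
Qed.

(** Closedness puts the union of the two facets into one clique, which shares a whole facet with
    each of [Gam] and [Gam']; [cliques_share] identifies all three. *)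
Lemma position_clique sigma Gam Gam' (f g : 'I_m.+1 -> 'I_n) i :
  JDelta_prime K m.+1 n D -> closed_wrt n m.+1 sigma D ->
  Gam \in cliques n m.+1 D -> Gam' \in cliques n m.+1 D ->
  increasing sigma f -> increasing sigma g ->
  (forall j, f j \in Gam) -> (forall j, g j \in Gam') -> f i = g i -> Gam = Gam'.
Proof.
move=> primeJ cl cG cG' fincr gincr fG gG fg.
set A := [set f j | j : 'I_m.+1]; set B := [set g j | j : 'I_m.+1].
have AG : A \subset Gam by apply/subsetP=> _ /imsetP[j _ ->].
have BG : B \subset Gam' by apply/subsetP=> _ /imsetP[j _ ->].
have cA : #|A| = m.+1 by rewrite card_imset ?card_ord //; apply: increasing_inj fincr.
have cB : #|B| = m.+1 by rewrite card_imset ?card_ord //; apply: increasing_inj gincr.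
have AD : A \in D by have /in_SP[_ sub] := clique_in_S cG; apply: sub.
have BD : B \in D by have /in_SP[_ sub] := clique_in_S cG'; apply: sub.
have SU : in_S n m.+1 D (A :|: B).
  apply/in_SP; split; last exact: (closed_increasing cl fincr gincr AD BD fg).
  by rewrite -[X in (X <= _)%N]cA subset_leq_card // subsetUl.
have [Gam0 c0 U0] := in_S_clique SU; move: U0; rewrite subUset => /andP[A0 B0].
have -> : Gam = Gam0.
  apply: cliques_share => //; apply: (@leq_trans #|A|); first by rewrite cA.
  by rewrite subset_leq_card // subsetI AG.
apply: cliques_share => //; apply: (@leq_trans #|B|); first by rewrite cB.
by rewrite subset_leq_card // subsetI BG B0.
Qed.

End Cliques.

(** * A matrix annihilated by the facet ideal *)

(** The product is the determinant of [A] with column [j] replaced by the monomial in row [k] and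
    zeros elsewhere. Its diagonal dominates, and meets the monomial only if [k = j]. *)
Lemma coef_cofactor (K : fieldType) m (A : 'M[{poly K}]_m) (a d : 'I_m -> nat) j k :
  {homo a : i l / (i < l)%N} ->
  (forall i l, l != j -> size (A i l) <= (i * a l + d l).+1)%N ->
  let E := (\sum_(i < m | i != j) (i * a i + d i) + j * a j)%N in
  (size (cofactor A k j * 'X^(k * a j))%R <= E.+1)%N /\
  (cofactor A k j * 'X^(k * a j))`_E =
    if k == j then \prod_(i < m | i != j) (A i i)`_(i * a i + d i) else 0.
Proof.
move=> amono leA E.
pose d' i := if i == j then 0%N else d i.
pose y (i : 'I_m) : {poly K} := if i == k then 'X^(k * a j) else 0.
have detE : \det (replace_col A j y) = cofactor A k j * 'X^(k * a j).
  rewrite det_replace_col (bigD1 k) //= /y eqxx big1 ?addr0 // => i /negPf->.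
  by rewrite mulr0.
have leB i l : (size (replace_col A j y i l) <= (i * a l + d' l).+1)%N.
  rewrite mxE /d' /y; case: (eqVneq l j) => [->|lj]; last exact: leA.
  by case: (eqVneq i k) => [->|_]; rewrite ?size_poly0 // size_polyXn addn0.
have E1 : (\sum_(i < m) (i * a i + d' i) = E)%N.
  rewrite (bigD1 j) //= /d' eqxx addn0 addnC; congr (_ + _)%N.
  by apply: eq_bigr => i /negPf->.
have [] := coef_det_diag amono leB; rewrite /= E1 detE => -> ->; split=> //.
rewrite (bigD1 j) //= !mxE eqxx /d' eqxx addn0 /y eq_sym.
case: (eqVneq k j) => [->|_]; last by rewrite coef0 mul0r.
rewrite coefXn eqxx mul1r; apply: eq_bigr => i ij.
by rewrite mxE (negPf ij).
Qed.

Section DegeneratePoint.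
Variables (K : fieldType) (m n : nat) (D : {set {set 'I_n}}).
Variables (sigma : {perm 'I_n}) (v : 'I_n).
Hypothesis pureD : forall F, F \in D -> #|F| = m.+1.
Hypothesis closedD : closed_wrt n m.+1 sigma D.

(** The last entry of such a column is forced by a facet, so its top coefficient is not
    controlled. *)
Definition top_vertex (c : 'I_n) : bool :=
  [exists G in D, [&& v \notin G, c \in G & [forall y in G, sigma y <= sigma c]]]%N.

Lemma increasing_le (f : 'I_m.+1 -> 'I_n) j :
  increasing sigma f -> (sigma (f j) <= sigma (f ord_max))%N.
Proof.
move=> fincr; have := leq_ord j; rewrite leq_eqVlt => /orP[/eqP jm|jm].
  by have -> : j = ord_max by apply: val_inj.
exact/ltnW/fincr.
Qed.

Lemma top_vertexP c :
  reflect (exists g : 'I_m.+1 -> 'I_n, [/\ increasing sigma g,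
    [set g i | i : 'I_m.+1] \in D, forall i, g i != v & g ord_max = c])
  (top_vertex c).
Proof.
apply: (iffP existsP) => [[G /andP[GD /and3P[vG cG /forallP leG]]]|[g [gincr GD gv gc]]].
  have [g gincr gG] := increasing_enum sigma (pureD GD).
  exists g; split; rewrite ?gG //.
    by move=> i; apply: contraNneq vG => <-; rewrite -gG imset_f.
  have [i _ ci] : exists2 i, i \in 'I_m.+1 & c = g i by apply/imsetP; rewrite gG.
  have := leG (g ord_max); rewrite -gG imset_f //= => le.
  apply/(@perm_inj _ sigma)/val_inj/eqP; rewrite eqn_leq le /= ci.
  exact: increasing_le.
exists [set g i | i : 'I_m.+1]; rewrite GD /=; apply/and3P; split.
- by apply/imsetP=> -[i _ vi]; have := gv i; rewrite -vi eqxx.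
- by rewrite -gc imset_f.
apply/forallP=> y; apply/implyP=> /imsetP[i _ ->]; rewrite -gc.
exact: increasing_le.
Qed.

Let facet_map (g : 'I_m.+1 -> 'I_n) :=
  injective g -> [set g i | i : 'I_m.+1] \in D.

(* Columns are chosen by increasing label; the last entry of the column of a
   top vertex is dictated by one facet, and closedness makes this consistent
   with all the other facets having the same top vertex. *)
Lemma degenerate_point_below N :
  exists (x : 'I_m.+1 -> 'I_n -> {poly K}) (d : 'I_n -> nat),
  [/\ forall i c, (size (x i c) <= (i * sigma c + d c).+1)%N,
      forall (i : 'I_m.+1) c, c != v -> (sigma c < N)%N ->
        (i < m)%N || ~~ top_vertex c -> (x i c)`_(i * sigma c + d c) != 0 &
      forall g, facet_map g -> (forall j, g j != v) ->
        (forall j, sigma (g j) < N)%N -> \det (colmx x g) = 0].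
Proof.
elim: N => [|N [x [d [szx topx x0]]]].
  exists (fun _ _ => 0), (fun=> 0%N); split=> // [i c|g _ _ /(_ ord0)//].
  by rewrite size_poly0.
have [leN|ltN] := leqP n N.
  exists x, d; split=> // [i c cv _|g gD gv _].
    by apply: topx => //; apply: leq_trans leN.
  by apply: x0 => // j; apply: leq_trans leN.
pose c0 := (sigma^-1)%g (Ordinal ltN).
have sc0 : sigma c0 = N :> nat by rewrite permKV.
have eqc0 c : (c == c0) = (sigma c == N :> nat).
  by rewrite -sc0 val_eqE (inj_eq perm_inj).
have ltc0 c : c != c0 -> (sigma c < N.+1)%N -> (sigma c < N)%N.
  by rewrite eqc0 ltnS leq_eqVlt => /negPf->.
pose upd (y : 'I_m.+1 -> {poly K}) i c := if c == c0 then y i else x i c.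
have old y g : facet_map g -> (forall j, g j != v) ->
    (forall j, sigma (g j) < N)%N -> \det (colmx (upd y) g) = 0.
  move=> gD gv gN; rewrite -(x0 g gD gv gN); congr (\det _).
  by apply/matrixP=> i j; rewrite !mxE /upd eqc0 ltn_eqF.
(* The last vertex of a facet has the largest label, so facets not ending in [c0] involve only old
   columns. *)
have reduce y : (forall h, increasing sigma h -> [set h i | i : 'I_m.+1] \in D ->
      (forall j, h j != v) -> h ord_max = c0 -> \det (colmx (upd y) h) = 0) ->
    forall g, facet_map g -> (forall j, g j != v) ->
      (forall j, sigma (g j) < N.+1)%N -> \det (colmx (upd y) g) = 0.
  move=> zero_top g gD gv gN.
  case: (boolP (injectiveb g)) => [/injectiveP ginj|]; last exact: det_colmx_noninj.
  have [h hincr hg] := increasing_enum sigma (pureD (gD ginj)).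
  have hD : [set h i | i : 'I_m.+1] \in D by rewrite hg; apply: gD.
  have hE j : exists i, h j = g i.
    have : h j \in [set g i | i : 'I_m.+1] by rewrite -hg imset_f.
    by case/imsetP=> i _ ->; exists i.
  have hv j : h j != v by have [i ->] := hE j.
  apply: (det_colmx_eq0 ginj (esym hg)).
  have [hc|hc] := eqVneq (h ord_max) c0; first exact: zero_top.
  apply: old => // j; apply: leq_ltn_trans (increasing_le j hincr) _.
  by apply: ltc0 => //; have [i ->] := hE ord_max.
have [top0|ntop0] := boolP (top_vertex c0); last first.
  (* No facet avoiding [v] ends in [c0]: the column is free, and monomials attain the degree
     bounds. *)
  exists (upd (fun i => 'X^(i * N))), (fun c => if c == c0 then 0%N else d c); split.
  - move=> i c; rewrite /upd; case: eqP => [->|//].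
    by rewrite size_polyXn sc0 addn0.
  - move=> i c cv cN ic; rewrite /upd; case: (eqVneq c c0) => [->|cc0].
      by rewrite sc0 addn0 coefXn eqxx oner_eq0.
    by apply: topx => //; apply: ltc0.
  apply: reduce => h hincr hD hv hc; case/negP: ntop0.
  by apply/top_vertexP; exists h.
have [g0 [g0incr g0D g0v g0c]] := top_vertexP _ top0.
have g0inj := increasing_inj g0incr.
have g0lt j : j != ord_max -> (sigma (g0 j) < N)%N.
  move=> jm; rewrite -sc0 -g0c; apply: g0incr => /=.
  by rewrite ltn_neqAle leq_ord andbT; apply: contraNneq jm => e; apply/eqP/val_inj.
have g0nc j : j != ord_max -> (g0 j == c0) = false.
  by move=> jm; rewrite eqc0 ltn_eqF // g0lt.
pose C r := cofactor (colmx x g0) r ord_max.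
(* This solves [\sum_r C r * y r = 0], the vanishing of the minor of [g0]; the factor [C ord_max]
   avoids a division. *)
pose y (i : 'I_m.+1) : {poly K} :=
  if i == ord_max then - \sum_(r < m.+1 | r != ord_max) C r * 'X^(r * N)
  else C ord_max * 'X^(i * N).
pose d0 := (\sum_(j < m.+1 | j != ord_max) (j * sigma (g0 j) + d (g0 j)))%N.
have amono : {homo (fun j => sigma (g0 j) : nat) : i l / (i < l)%N} by exact: g0incr.
have leC i l : l != ord_max ->
    (size (colmx x g0 i l) <= (i * sigma (g0 l) + d (g0 l)).+1)%N.
  by move=> _; rewrite mxE.
(* With [d0] as the shift of [c0], [d0 + m * N] is the degree bound required of the last entry of
   [y]. *)
have topC r : (size (C r * 'X^(r * N))%R <= (d0 + m * N).+1)%N /\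
    (C r * 'X^(r * N))`_(d0 + m * N) = if r == ord_max then
      \prod_(i < m.+1 | i != ord_max) (colmx x g0 i i)`_(i * sigma (g0 i) + d (g0 i)) else 0.
  by have := coef_cofactor r amono leC; rewrite /= g0c sc0.
(* The diagonal uses only rows [i < m], where top coefficients are nonzero even for top vertices. *)
have Cd0 : (C ord_max)`_d0 != 0.
  have [_] := topC ord_max; rewrite eqxx coefMXn ltnNge leq_addl /= addnK => ->.
  apply/prodf_neq0 => i im; rewrite mxE; apply: topx; rewrite ?g0lt //.
  by rewrite ltn_neqAle leq_ord andbT; apply/orP; left; apply: contraNneq im => e; apply/eqP/val_inj.
have Cn0 : C ord_max != 0 by apply: contraNneq Cd0 => ->; rewrite coef0.
have szC : (size (C ord_max) <= d0.+1)%N.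
  have [] := topC ord_max; rewrite size_mulXn //= => + _; lia.
exists (upd y), (fun c => if c == c0 then d0 else d c); split.
- move=> i c; rewrite /upd; case: eqP => [->|//]; rewrite sc0 /y.
  case: eqP => [->|_] /=.
    rewrite size_polyN addnC; apply: leq_trans (size_sum _ _ _) _.
    by apply/bigmax_leqP=> r _; have [] := topC r.
  by rewrite size_mulXn // -addnS leq_add2l.
- move=> i c cv cN ic; rewrite /upd; case: (eqVneq c c0) ic => [->|cc0] ic; last first.
    by apply: topx => //; apply: ltc0.
  move: ic; rewrite top0 orbF => im; rewrite sc0 /y.
  have -> : (i == ord_max) = false by rewrite -val_eqE ltn_eqF.
  by rewrite coefMXn ltnNge leq_addr /= addKn.
apply: reduce => h hincr hD hv hc.
(* For any facet [h] ending in [c0], it suffices to treat the first [m] vertices of [g0] with one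
   vertex of [h]. If that vertex is [c0], the choice of [y] applies; otherwise all labels are below
   [N], and closedness yields an old facet unless a vertex repeats. *)
pose P := replace_col (colmx x g0) ord_max (fun k => (k == ord_max)%:R).
have detP : \det P = C ord_max.
  rewrite det_replace_col (bigD1 ord_max) //= eqxx mulr1 big1 ?addr0 // => k /negPf->.
  by rewrite mulr0.
have : \det P ^+ m.+1 * \det (colmx (upd y) h) = 0.
  apply: (det_adj_row_ideal (zero_is_ideal _) (j := ord_max)) => c.
  rewrite adj_mulmx.
  have [hcc|hcc] := eqVneq (h c) c0.
    have -> : replace_col P ord_max (fun k => colmx (upd y) h k c) =
              replace_col (colmx x g0) ord_max y.
      apply/matrixP=> i j; rewrite !mxE; case: eqP => // _.
      by rewrite /upd hcc eqxx.
    rewrite det_replace_col (bigD1 ord_max) //= {1}/y eqxx -/(C _) mulrN mulr_sumr.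
    apply/eqP; rewrite addrC subr_eq0; apply/eqP/eq_bigr => k km.
    by rewrite /y (negPf km) mulrCA.
  have -> : replace_col P ord_max (fun k => colmx (upd y) h k c) =
            colmx (upd y) (replace_at g0 ord_max (h c)).
    apply/matrixP=> i j; rewrite !mxE /replace_at; case: eqP => // /eqP jm.
    by rewrite /upd g0nc.
  apply: old => [ginj|j|j]; rewrite ?/replace_at; last 2 first.
  - by case: (eqVneq j ord_max).
  - case: (eqVneq j ord_max) => [_|/g0lt//]; apply: ltc0 => //; rewrite ltnS -sc0 -hc.
    exact: increasing_le.
  have g0h : g0 ord_max = h ord_max by rewrite g0c hc.
  apply: (closed_increasing closedD g0incr hincr g0D hD g0h).
    apply/subsetP=> _ /imsetP[j _ ->]; rewrite /replace_at inE.
    by case: eqP => _; rewrite imset_f ?orbT.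
  by rewrite card_imset ?card_ord.
by move/eqP; rewrite mulf_eq0 detP expf_eq0 (negPf Cn0) andbF => /eqP.
Qed.

(** Zeroing the column [v] kills the minors through [v]; the construction with [N = n] handles the
    others. *)
Lemma degenerate_point :
  exists (x : 'I_m.+1 -> 'I_n -> {poly K}) (d : 'I_n -> nat),
  [/\ forall i c, (size (x i c) <= (i * sigma c + d c).+1)%N,
      forall (i : 'I_m.+1) c, c != v -> (i < m)%N || ~~ top_vertex c ->
        (x i c)`_(i * sigma c + d c) != 0 &
      forall g, injective g -> [set g i | i : 'I_m.+1] \in D ->
        \det (colmx x g) = 0].
Proof.
have [x [d [szx topx x0]]] := degenerate_point_below n.
exists (fun i c => if c == v then 0 else x i c), d; split.
- by move=> i c; case: eqP => _; rewrite ?size_poly0.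
- by move=> i c cv ic; rewrite (negPf cv); apply: topx.
move=> g ginj gD; have [gv|] := boolP [forall j, g j != v].
  rewrite -(x0 g) //; last exact/forallP.
  congr (\det _); apply/matrixP=> i j; rewrite !mxE.
  by move/forallP/(_ j): gv => /negPf->.
rewrite negb_forall => /existsP[j]; rewrite negbK => gj.
by rewrite (expand_det_col _ j) big1 // => i _; rewrite mxE gj mul0r.
Qed.

End DegeneratePoint.

(** * Normal vectors of cliques *)

Section DeletedVertex.
Variables (K : fieldType) (m n : nat) (D : {set {set 'I_n}}).
Variables (sigma : {perm 'I_n}) (v : 'I_n).
Implicit Types Gam : {set 'I_n}.
Hypothesis pureD : forall F, F \in D -> #|F| = m.+1.
Hypothesis closedD : closed_wrt n m.+1 sigma D.
Hypothesis primeJ : JDelta_prime K m.+1 n D.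

(* The facet consists of v and the first m - 1 other vertices of the clique. *)
Lemma initial_facet Gam : Gam \in cliques n m.+1 D -> v \in Gam ->
  exists (f : 'I_m.+1 -> 'I_n) (p : 'I_m.+1),
  [/\ increasing sigma f, forall j, f j \in Gam, f p = v &
      p != ord_max -> ~~ top_vertex D sigma v (f ord_max)].
Proof.
move=> cG vG; have /in_SP[mG _] := clique_in_S cG.
set N := #|Gam :\ v|.
have mN : (m <= N)%N by move: mG; rewrite (cardsD1 v) vG.
have [g gincr gG] := increasing_enum sigma (erefl N).
have ginj := increasing_inj gincr.
have gmem i : g i \in Gam :\ v by rewrite -gG imset_f.
pose Q := [set g (widen_ord mN i) | i : 'I_m].
have QG : Q \subset Gam :\ v by apply/subsetP=> _ /imsetP[i _ ->].
have cQ : #|Q| = m.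
  by rewrite card_imset ?card_ord // => i j /ginj/(congr1 val) ?; apply: val_inj.
have vQ : v \notin Q by apply/negP => /(subsetP QG); rewrite !inE eqxx.
have cF : #|v |: Q| = m.+1 by rewrite cardsU1 vQ cQ.
have [f fincr fF] := increasing_enum sigma cF.
have fmem j : f j \in v |: Q by rewrite -fF imset_f.
have fG j : f j \in Gam.
  have := fmem j; rewrite inE => /orP[/set1P->//|/(subsetP QG)].
  by rewrite inE => /andP[].
have [p _ fp] : exists2 p, p \in 'I_m.+1 & v = f p.
  by apply/imsetP; rewrite fF setU11.
(* A facet [h] avoiding [v] and ending in [f ord_max] would lie in [Gam] by [position_clique]. None
   of its [m.+1] vertices could come after [f ord_max], so all would lie in [Q], which has only [m]
   elements. *)
exists f, p; split=> // pm; apply/negP => /(top_vertexP _ _ pureD)[h [hincr hD hv hf]].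
have [Gam' cG' hG'] := facet_clique pureD hD.
have hG'j j : h j \in Gam' by apply: (subsetP hG'); apply: imset_f.
have eG : Gam' = Gam.
  by apply: (position_clique (i := ord_max) pureD primeJ closedD cG' cG hincr fincr).
have fQ : f ord_max \in Q.
  have := fmem ord_max; rewrite inE => /orP[/set1P fv|//].
  by case/negP: pm; rewrite -(inj_eq (increasing_inj fincr)) fv -fp.
have [i0 _ fi0] := imsetP fQ.
suff hQ : [set h j | j : 'I_m.+1] \subset Q.
  by have := subset_leq_card hQ; rewrite cQ (pureD hD) ltnn.
apply/subsetP=> _ /imsetP[j _ ->].
have : h j \in Gam :\ v by rewrite !inE hv -eG hG'j.
rewrite -gG => /imsetP[i _ hi]; rewrite hi.
have im : (i < m)%N.
  apply: leq_ltn_trans (ltn_ord i0); rewrite leqNgt; apply/negP => lt.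
  have : (sigma (g (widen_ord mN i0)) < sigma (g i))%N by apply: gincr.
  by rewrite -fi0 -hi -hf ltnNge increasing_le.
apply/imsetP; exists (Ordinal im) => //; congr (g _); exact: val_inj.
Qed.

(** Row [j] of the adjugate consists of cofactors along column [j], hence is normal to all other
    columns of [f]. Unit rows at [None] reduce the determinant to a principal minor. *)
Definition normal_rows (R : comNzRingType) (x : 'I_m.+1 -> 'I_n -> R)
  (q : 'I_m.+1 -> option ('I_m.+1 -> 'I_n)) : 'M[R]_m.+1 :=
  \matrix_(j, k) (if q j is Some f then (\adj (colmx x f)) j k else (j == k)%:R).

Lemma normal_rows_notin (q : 'I_m.+1 -> option ('I_m.+1 -> 'I_n)) :
  (forall j f, q j = Some f -> [/\ increasing sigma f, f j = v &
     j != ord_max -> ~~ top_vertex D sigma v (f ord_max)]) ->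
  ~ in_JDelta K m.+1 n D
      (\det (normal_rows (fun i c => xvar K m.+1 n i c) q)).
Proof.
move=> qP; have [x [d [szx topx x0]]] := degenerate_point K v pureD closedD.
have [phi phix] := Sring_eval x.
move=> /(JDelta_eval pureD phix) phi0.
have: \det (normal_rows x q) = 0.
  rewrite -phi0 // -det_map_mx; congr (\det _).
  apply/matrixP=> j k; rewrite !mxE; case: (q j) => [f|]; last by rewrite rmorph_nat.
  rewrite mxE [X in phi X]mxE -cofactor_map_mx.
  by congr (cofactor _ k j); apply/matrixP=> a b; rewrite !mxE phix.
(* The column scaling supplies the monomial of [coef_cofactor]: in row [j] only the diagonal entry
   can have degree [e j]. *)
pose A := normal_rows x q *m diag_mx (\row_k 'X^(k * sigma v)).
pose E (j : 'I_m.+1) (f : 'I_m.+1 -> 'I_n) :=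
  (\sum_(i < m.+1 | i != j) (i * sigma (f i) + d (f i)) + j * sigma v)%N.
pose e j := if q j is Some f then E j f else (j * sigma v)%N.
pose c j : K := if q j is Some f then
    \prod_(i < m.+1 | i != j) (x i (f i))`_(i * sigma (f i) + d (f i)) else 1.
have AE j k : (size (A j k) <= (e j).+1)%N /\ (A j k)`_(e j) = if k == j then c j else 0.
  rewrite /A mul_mx_diag !mxE /e /c; case qj: (q j) => [f|].
    have [fincr fj _] := qP _ _ qj; rewrite mxE.
    have amono : {homo (fun j => sigma (f j) : nat) : i l / (i < l)%N} by exact: fincr.
    have szf i l : l != j ->
      (size (colmx x f i l) <= (i * sigma (f l) + d (f l)).+1)%N by rewrite mxE.
    have := coef_cofactor k amono szf; rewrite /= fj -/(E j f) => -[-> ->].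
    split=> //; case: eqP => // _; apply: eq_bigr => i _.
    by rewrite mxE.
  case: (eqVneq k j) => [->|kj]; first by rewrite mul1r size_polyXn coefXn eqxx.
  by rewrite mul0r size_poly0 coef0.
move=> U0; have detA : \det A = 0 by rewrite det_mulmx U0 mul0r.
have := coef_det_rows (fun j k => (AE j k).1).
rewrite detA coef0 => /esym/eqP; apply/negP.
have -> : \matrix_(i, j) (A i j)`_(e i) = diag_mx (\row_i c i).
  apply/matrixP=> i j; rewrite mxE (AE i j).2 !mxE eq_sym.
  by case: eqP => [->|]; rewrite ?mulr1n ?mulr0n.
rewrite det_diag; apply/prodf_neq0 => j _; rewrite mxE /c.
case qj: (q j) => [f|]; last exact: oner_neq0.
have [fincr fj ftop] := qP _ _ qj.
apply/prodf_neq0 => i ij; apply: topx.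
  by rewrite -fj (inj_eq (increasing_inj fincr)).
(* In the last row [i != j] gives [j != ord_max], so [f ord_max] is not a top vertex. *)
have := leq_ord i; rewrite leq_eqVlt => /orP[/eqP im|->//].
have {}im : i = ord_max by apply: val_inj.
by rewrite im ftop ?orbT // -im eq_sym.
Qed.

End DeletedVertex.

(** * Common vertices of several cliques *)

Theorem theorem2p2 (K : fieldType) (m n : nat) (D : {set {set 'I_n}}) :
  (m <= n)%N ->
  pure_dim n m D ->
  closed_complex n m D ->
  JDelta_prime K m n D ->
  forall t : nat, (2 <= t)%N -> (t <= minn m #|cliques n m D|)%N ->
  forall T : {set {set 'I_n}}, T \subset cliques n m D -> #|T| = t ->
    (#|\bigcap_(Gam in T) Gam| <= m - t)%N.
Proof.
move=> _ [_ pureD] [sigma closedD] primeJ t t2; rewrite leq_min => /andP[tm _].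
move=> T Tsub cT; rewrite leqNgt; apply/negP.
case: m pureD closedD primeJ tm Tsub => [|{}m] pureD closedD primeJ tm Tsub; first by lia.
set W := \bigcap_(Gam in T) Gam => ltW.
have [v vW] : exists v, v \in W by apply/card_gt0P; apply: leq_ltn_trans ltW.
have WG Gam c : Gam \in T -> c \in W -> c \in Gam by move=> GT /bigcapP; apply.
have cG Gam : Gam \in T -> Gam \in cliques n m.+1 D by apply: (subsetP Tsub).
have : forall Gam : {set 'I_n}, exists fp : ('I_m.+1 -> 'I_n) * 'I_m.+1,
    Gam \in T -> [/\ increasing sigma fp.1, forall j, fp.1 j \in Gam, fp.1 fp.2 = v &
      fp.2 != ord_max -> ~~ top_vertex D sigma v (fp.1 ord_max)].
  move=> Gam; case: (boolP (Gam \in T)) => GT; last by exists (fun=> v, ord0).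
  have [f [p fpP]] := initial_facet pureD closedD primeJ (cG _ GT) (WG _ _ GT vW).
  by exists (f, p).
case/fin_all_exists => F FP.
have Finj : {in T &, injective (fun Gam => (F Gam).2)}.
  move=> Gam Gam' GT GT' epp; have [i1 m1 v1 _] := FP _ GT; have [i2 m2 v2 _] := FP _ GT'.
  apply: (position_clique (i := (F Gam).2) pureD primeJ closedD (cG _ GT) (cG _ GT') i1 i2) => //.
  by rewrite v1 epp v2.
(* Row [j] receives the facet of the clique in [T] that has [v] at position [j], if there is one. *)
pose q (j : 'I_m.+1) := if [pick Gam in T | (F Gam).2 == j] is Some Gam
                        then Some (F Gam).1 else None.
have qP j f : q j = Some f -> exists2 Gam, Gam \in T & f = (F Gam).1 /\ (F Gam).2 = j.
  by rewrite /q; case: pickP => // Gam /andP[GT /eqP pj] [<-]; exists Gam.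
pose A := [set (F Gam).2 | Gam in T].
have cA : #|A| = t by rewrite card_in_imset.
have qA j : j \in A -> exists f, q j = Some f.
  case/imsetP=> Gam GT ->; rewrite /q; case: pickP => [Gam' _|/(_ Gam)]; first by exists (F Gam').1.
  by rewrite GT eqxx.
(* Facets now have [m.+1] vertices: [t + s] exceeds the matrix size by one, and [2 <= t] gives the
   bound [s <= m] of [partial_colmx_notin]. *)
pose s := (m.+2 - t)%N.
have sW : (s <= size (enum W))%N by rewrite -cardE /s; move: ltW; lia.
pose w (j : 'I_m.+1) := nth v (enum W) j.
have sm : (s <= m)%N by rewrite /s; lia.
pose xv (i : 'I_m.+1) (c : 'I_n) : Sring K m.+1 n := xvar K m.+1 n i c.
have nU : ~ in_JDelta K m.+1 n D (\det (normal_rows xv q)).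
  apply: (normal_rows_notin pureD closedD (v := v)) => j f /qP[Gam GT [-> <-]].
  by have [] := FP _ GT.
have nM : ~ in_JDelta K m.+1 n D (\det (partial_colmx s xv w)).
  apply: (partial_colmx_notin pureD sm) => i j is_ js /eqP.
  by rewrite nth_uniq ?enum_uniq ?(leq_trans is_) ?(leq_trans js) // => /eqP/val_inj.
suff : in_JDelta K m.+1 n D (\det (normal_rows xv q) * \det (partial_colmx s xv w)).
  by case/primeJ.2.
rewrite -det_mulmx.
apply: (det_block_ideal (A := A) (B := [set j : 'I_m.+1 | (j < s)%N]) (JDelta_is_ideal K m.+1 D)).
  rewrite cA; suff -> : #|[set j : 'I_m.+1 | (j < s)%N]| = s by rewrite /s; lia.
  have s1 : (s <= m.+1)%N by apply: leqW.
  rewrite -[RHS](card_ord s) -(card_imset _ (f := widen_ord s1)); last by move=> i j /(congr1 val) ?; apply: val_inj.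
  apply: eq_card => j; rewrite inE; apply/idP/imsetP => [js|[i _ ->]]; last exact: (ltn_ord i).
  by exists (Ordinal js) => //; apply: val_inj.
(* This entry is the minor of [f] with [v] at position [j] replaced by [w i]; all its columns belong
   to [Gam]. *)
move=> j i /qA[f qj]; rewrite inE => is_.
have [Gam GT [fE pj]] := qP _ _ qj; have [_ memf _ _] := FP _ GT.
have -> : (normal_rows xv q *m partial_colmx s xv w) j i =
          (\adj (colmx xv f) *m partial_colmx s xv w) j i.
  by rewrite !mxE; apply: eq_bigr => k _; rewrite [normal_rows _ _ _ _]mxE qj.
rewrite adj_mulmx.
have -> : replace_col (colmx xv f) j (fun k => partial_colmx s xv w k i) =
          colmx xv (replace_at f j (w i)).
  by apply/matrixP=> a b; rewrite !mxE /replace_at is_; case: eqP.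
apply: (clique_minor K pureD (cG _ GT)) => l; rewrite /replace_at.
case: eqP => [_|_]; last by rewrite fE.
by apply: WG => //; rewrite -mem_enum mem_nth // (leq_trans is_).
Qed.
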